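(* Let $M$ be an $n$-dimensional Riemannian manifold with Riemannian metric $g$, Levi-Civita connection $\nabla$ and curvature tensor $R$ of $\nabla$. Let $f_1,f_2$ be functions on $M$, let $u,u_1,u_2$ be $1$-forms on $M$, and let $\varphi$ be a $(1,1)$ tensor field on $M$. Let $U,U_1,U_2$ be the vector fields with $u(X)=g(U,X)$, $u_1(X)=g(U_1,X)$, $u_2(X)=g(U_2,X)$, and let $\varphi=\varphi_1+\varphi_2$, where $g(\varphi_1X,Y)$ and $g(\varphi_2X,Y)$ are respectively the symmetric and skew-symmetric parts of the $(0,2)$ tensor $\Phi(X,Y)=g(\varphi X,Y)$. Let $\tilde\nabla$ be the linear connection $$\tilde\nabla_XY=\nabla_XY+u(Y)\varphi_1X-u(X)\varphi_2Y-g(\varphi_1X,Y)U-f_1\{u_1(X)Y+u_1(Y)X-g(X,Y)U_1\}-f_2\,g(X,Y)U_2.$$ Then the curvature tensor $\tilde R$ of $\tilde\nabla$ is given, for all vector fields $X,Y,Z$, by $$\begin{aligned} \tilde R(X,Y)Z={}&R(X,Y)Z-2du(X,Y)\varphi_2Z-\alpha(u,Y,Z)\varphi_1X+\alpha(u,X,Z)\varphi_1Y\\ &-g(\varphi_1Y,Z)A(u,X)+g(\varphi_1X,Z)A(u,Y)-R_0\big(U,\mu(X,Y)-\mu(Y,X)\big)Z\\ &+u(X)(\nabla_Y\varphi_2)Z-u(Y)(\nabla_X\varphi_2)Z\\ &-f_1\big\{2du_1(X,Y)Z-\beta(u_1,Y,Z)X+\beta(u_1,X,Z)Y-g(Y,Z)B(u_1,X)+g(X,Z)B(u_1,Y)\\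 &\qquad+u(Y)R_0(\varphi X,U_1)Z-u(X)R_0(\varphi Y,U_1)Z\big\}\\ &+f_2\big\{g(\varphi Y,Z)u(X)U_2-g(\varphi X,Z)u(Y)U_2-g(Y,Z)B(u_2,X)+g(X,Z)B(u_2,Y)\big\}\\ &-(f_1)^2\big\{g(Y,Z)R_0(X,U_1)U_1-g(X,Z)R_0(Y,U_1)U_1-u_1(Z)R_0(X,Y)U_1\big\}\\ &+(f_2)^2\big\{g(Y,Z)u_2(X)U_2-g(X,Z)u_2(Y)U_2\big\}\\ &+f_1f_2\big\{g(Y,Z)\big(R_0(X,U_2)U_1-u_2(X)U_1\big)-g(X,Z)\big(R_0(Y,U_2)U_1-u_2(Y)U_1\big)\big\}\\ &-(Xf_1)\{u_1(Y)Z+u_1(Z)Y-g(Y,Z)U_1\}+(Yf_1)\{u_1(X)Z+u_1(Z)X-g(X,Z)U_1\}\\ &-(Xf_2)g(Y,Z)U_2+(Yf_2)g(X,Z)U_2. \end{aligned}$$ Here $\alpha,A,\beta,B,\mu,R_0$ are the expressions in $g,\nabla,u,U,\varphi_1,\varphi_2$ defined in the context.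
   Context: All functions, vector fields, $1$-forms and tensor fields are smooth. The curvature tensors are $\tilde R(X,Y)Z=\tilde\nabla_X\tilde\nabla_YZ-\tilde\nabla_Y\tilde\nabla_XZ-\tilde\nabla_{[X,Y]}Z$, and $R$ is defined in the same way from $\nabla$. The convention for the exterior derivative of a $1$-form $\eta$ is $2d\eta(X,Y)=(\nabla_X\eta)Y-(\nabla_Y\eta)X$. $Xf$ denotes the derivative of the function $f$ along $X$. For a $1$-form $\eta$ with associated vector field $\xi$, i.e. $\eta(X)=g(\xi,X)$, define $$\beta(\eta,X,Y)=(\nabla_X\eta)Y+u(X)\eta(\varphi_2Y)-\eta(\varphi_1X)u(Y)+\eta(U)g(\varphi_1X,Y),$$ $$B(\eta,X)=\nabla_X\xi-u(X)\varphi_2\xi-\eta(\varphi_1X)U+\eta(U)\varphi_1X,$$ $$\alpha(\eta,X,Y)=(\nabla_X\eta)Y+u(X)\eta(\varphi_2Y)-\eta(\varphi_1X)u(Y)+\tfrac12\eta(U)g(\varphi_1X,Y),$$ $$A(\eta,X)=\nabla_X\xi-u(X)\varphi_2\xi-\eta(\varphi_1X)U+\tfrac12\eta(U)\varphi_1X.$$ Also define $$\mu(X,Y)=(\nabla_X\varphi_1)Y-u(X)\varphi_2\varphi_1Y,\qquad R_0(X,Y)Z=g(Y,Z)X-g(X,Z)Y.$$ *)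

(* Defs.v *)
From HB Require Import structures.
From mathcomp Require Import all_boot all_order all_algebra.
From mathcomp Require Import all_classical all_reals all_analysis.
From mathcomp Require Import ring.

Set Implicit Arguments.
Unset Strict Implicit.
Unset Printing Implicit Defensive.

Import Order.TTheory GRing.Theory Num.Theory.
Import numFieldNormedType.Exports.

Local Open Scope classical_set_scope.
Local Open Scope ring_scope.

Section SmoothOnOpen.
Context {R : realType} {n : nat}.
Implicit Types (D : set 'rV[R]_n) (f g : 'rV[R]_n -> R).

(* For open [D]: all iterated partial derivatives of order at most [k] exist
   and are continuous at every point of [D]. *)
Fixpoint Ck (k : nat) D f : Prop :=
  (forall x, D x -> {for x, continuous f}) /\
  if k is k'.+1 then
    forall i : 'I_n, (forall x, D x -> derivable f x (delta_mx ord0 i)) /\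
                     Ck k' D (fun x => 'D_(delta_mx ord0 i) f x)
  else True.

Definition smooth_on D f : Prop := forall k, Ck k D f.

Lemma Ck_ext k D f g : open D -> (forall x, D x -> f x = g x) ->
  Ck k D f -> Ck k D g.
Proof.
move=> oD; have nearD h1 h2 : (forall x, D x -> h1 x = h2 x) ->
    forall x, D x -> \forall y \near x, h1 y = h2 y :> R.
  move=> h12 x Dx; apply: filterS (fun y => h12 y) _.
  by move: oD; rewrite openE; apply.
have cont (h1 h2 : 'rV[R]_n -> R) : (forall x, D x -> h1 x = h2 x) ->
    (forall x, D x -> {for x, continuous h1}) ->
    forall x, D x -> {for x, continuous h2}.
  move=> h12 c1 x Dx; rewrite /prop_for /continuous_at -(h12 x Dx).
  apply: cvg_trans (c1 x Dx).
  exact: (@near_eq_cvg _ _ (nbhs x) _ _ _ (nearD _ _ h12 x Dx)).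
elim: k f g => [|k IH] f g fg /= [cf df]; split; do ?exact: cont cf.
  by [].
move=> i; have [di Ci] := df i; split=> [x Dx|].
  exact: near_eq_derivable (nearD _ _ fg x Dx) (di x Dx).
by apply: IH Ci => x Dx; apply: near_eq_derive; exact: nearD Dx.
Qed.

Lemma Ck_pred k D f : Ck k.+1 D f -> Ck k D f.
Proof.
elim: k f => [|k IH] f [cf df]; first by split.
by split=> // i; have [di Ci] := df i; split=> //; exact: IH.
Qed.

Lemma Ck_cst k D (c : R) : open D -> Ck k D (fun=> c).
Proof.
move=> oD; have cc (a : R) x : D x -> {for x, continuous (fun=> a : R)}.
  by move=> _; exact: (@cst_continuous 'rV[R]_n R).
elim: k c => [|k IH] c; (split; first exact: cc) => //.
move=> i; split=> [x _|]; first exact: derivable_cst.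
by apply: (Ck_ext oD _ (IH 0)) => x _; rewrite derive_cst.
Qed.

Lemma Ck_add k D f g : open D -> Ck k D f -> Ck k D g ->
  Ck k D (fun x => f x + g x).
Proof.
move=> oD; have cD (h1 h2 : 'rV[R]_n -> R) x : {for x, continuous h1} ->
    {for x, continuous h2} -> {for x, continuous (fun y => h1 y + h2 y)}.
  by move=> c1 c2; exact: (@cvgD _ _ _ (nbhs x) _ h1 h2).
elim: k f g => [|k IH] f g [cf df] [cg dg];
  (split; first by move=> x Dx; apply: cD; [exact: cf|exact: cg]) => //.
move=> i; have [dfi Cfi] := df i; have [dgi Cgi] := dg i; split=> [x Dx|].
  by apply: derivableD; [exact: dfi|exact: dgi].
apply: (Ck_ext oD _ (IH _ _ Cfi Cgi)) => x Dx.
by rewrite -deriveD; [|exact: dfi|exact: dgi].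
Qed.

Lemma Ck_mul k D f g : open D -> Ck k D f -> Ck k D g ->
  Ck k D (fun x => f x * g x).
Proof.
move=> oD; have cM (h1 h2 : 'rV[R]_n -> R) x : {for x, continuous h1} ->
    {for x, continuous h2} -> {for x, continuous (fun y => h1 y * h2 y)}.
  by move=> c1 c2; exact: (@cvgM _ _ (nbhs x) _ h1 h2).
elim: k f g => [|k IH] f g Cf Cg; have [cf df] := Cf; have [cg dg] := Cg;
  (split; first by move=> x Dx; apply: cM; [exact: cf|exact: cg]) => //.
move=> i; have [dfi Cfi] := df i; have [dgi Cgi] := dg i; split=> [x Dx|].
  by apply: derivableM; [exact: dfi|exact: dgi].
have C := Ck_add oD (IH _ _ (Ck_pred Cf) Cgi) (IH _ _ (Ck_pred Cg) Cfi).
apply: (Ck_ext oD _ C) => x Dx.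
by rewrite -[RHS]/('D_(delta_mx ord0 i) (f * g) x) deriveM;
  [|exact: dfi|exact: dgi].
Qed.

End SmoothOnOpen.

Record chart (R : realType) (n : nat) (T : topologicalType) := Chart {
  chart_dom : set T;
  chart_map :> T -> 'rV[R]_n;
  chart_inv : 'rV[R]_n -> T;
  chart_dom_open : open chart_dom;
  chart_img_open : open (chart_map @` chart_dom);
  chart_mapK : forall x, chart_dom x -> chart_inv (chart_map x) = x;
  chart_map_cont : forall x, chart_dom x -> {for x, continuous chart_map};
  chart_inv_cont : forall y, (chart_map @` chart_dom) y ->
    {for y, continuous chart_inv} }.

Record manifold (R : realType) (n : nat) := Manifold {
  carrier :> topologicalType;
  manifold_hausdorff : hausdorff_space carrier;
  manifold_second_countable : @second_countable carrier;
  (* any smooth atlas, not necessarily maximal *)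
  atlas : set (chart R n carrier);
  atlas_cover : forall p, exists2 c, atlas c & chart_dom c p;
  atlas_compat : forall c d, atlas c -> atlas d -> forall j : 'I_n,
    smooth_on (c @` (chart_dom c `&` chart_dom d))
              (fun y => d (chart_inv c y) ord0 j) }.

Section SmoothFunctions.
Context {R : realType} {n : nat} (M : manifold R n).

Definition is_smooth (f : M -> R) : Prop :=
  forall c, atlas c -> smooth_on (c @` chart_dom c) (f \o chart_inv c).

Definition smooth_pred : {pred (M -> R)} := fun f => `[< is_smooth f >].

Record smooth_fun := SmoothFun {
  sf_val :> M -> R;
  sf_in : sf_val \in smooth_pred }.

Lemma is_smooth_sf (f : smooth_fun) : is_smooth f.
Proof. by case: f => f /= /asboolP. Qed.

Definition mk_sf (f : M -> R) (fP : is_smooth f) : smooth_fun :=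
  SmoothFun (introT (asboolP _) fP).

Lemma is_smooth_cst (c : R) : is_smooth (fun=> c).
Proof. by move=> d _ k; apply: Ck_cst; exact: chart_img_open. Qed.

Lemma is_smoothD (f g : M -> R) :
  is_smooth f -> is_smooth g -> is_smooth (fun p => f p + g p).
Proof.
by move=> fP gP c Ac k; exact: (Ck_add (@chart_img_open _ _ _ c) (fP c Ac k) (gP c Ac k)).
Qed.

Lemma is_smoothM (f g : M -> R) :
  is_smooth f -> is_smooth g -> is_smooth (fun p => f p * g p).
Proof.
by move=> fP gP c Ac k; exact: (Ck_mul (@chart_img_open _ _ _ c) (fP c Ac k) (gP c Ac k)).
Qed.

Lemma is_smoothN (f : M -> R) : is_smooth f -> is_smooth (fun p => - f p).
Proof.
move=> fP; rewrite (_ : (fun _ => _) = fun p => -1 * f p).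
  exact: is_smoothM (is_smooth_cst _) fP.
by apply/funext => p; rewrite mulN1r.
Qed.

Fact smooth_subring_closed : subring_closed smooth_pred.
Proof.
split=> [|f g /asboolP fP /asboolP gP|f g /asboolP fP /asboolP gP].
- exact/asboolP/(is_smooth_cst 1).
- exact/asboolP/is_smoothD/is_smoothN.
- exact/asboolP/is_smoothM.
Qed.

HB.instance Definition _ := [isSub for sf_val].
HB.instance Definition _ := [Choice of smooth_fun by <:].
HB.instance Definition _ :=
  GRing.SubChoice_isSubComPzRing.Build (M -> R) smooth_pred smooth_fun
    smooth_subring_closed.

Definition sf_cst (c : R) : smooth_fun := mk_sf (is_smooth_cst c).

Lemma sf_ext (f g : smooth_fun) : (forall p, f p = g p) -> f = g.
Proof. by move=> fg; apply/val_inj/funext. Qed.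

End SmoothFunctions.

Section Tangent.
Context {R : realType} {n : nat} (M : manifold R n).

(* Tangent vectors at [p] are the R-linear derivations at [p] of the ring of
   smooth functions on [M]. *)
Definition is_derivation_at (p : M) (v : smooth_fun M -> R) : Prop :=
  (forall (a : R) f h, v (sf_cst M a * f + h) = a * v f + v h) /\
  (forall f h, v (f * h) = f p * v h + h p * v f).

Definition tangent_pred (p : M) : {pred (smooth_fun M -> R^o)} :=
  fun v => `[< is_derivation_at p v >].

Record tangent (p : M) := Tangent {
  tv :> smooth_fun M -> R^o;
  tv_in : tv \in tangent_pred p }.

Variable p : M.

Lemma is_derivation_tv (v : tangent p) : is_derivation_at p v.
Proof. by case: v => v /= /asboolP. Qed.

Definition mk_tv (v : smooth_fun M -> R) (vP : is_derivation_at p v) : tangent p :=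
  Tangent (introT (asboolP _) vP).

Fact tangent_submod_closed : submod_closed (tangent_pred p).
Proof.
split=> [|a v w /asboolP[v1 v2] /asboolP[w1 w2]]; apply/asboolP; split.
- by move=> a f h; rewrite /= mulr0 addr0.
- by move=> f h; rewrite /= !mulr0 addr0.
- move=> b f h; rewrite -![(_ + _) _]/(a * v _ + w _) v1 w1.
  by rewrite !mulrDr !addrA; congr (_ + _); rewrite mulrCA addrAC.
- move=> f h; rewrite -![(_ + _) _]/(a * v _ + w _) v2 w2.
  by rewrite !mulrDr addrACA [a * (f p * _)]mulrCA [a * (h p * _)]mulrCA.
Qed.

HB.instance Definition _ :=
  GRing.isSubmodClosed.Build R (smooth_fun M -> R^o) (tangent_pred p)
    tangent_submod_closed.
HB.instance Definition _ := [isSub for @tv p].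
HB.instance Definition _ := [Choice of tangent p by <:].
HB.instance Definition _ := [SubChoice_isSubLmodule of tangent p by <:].

Lemma tv_ext (v w : tangent p) : (forall f, v f = w f) -> v = w.
Proof. by move=> vw; apply/val_inj/funext. Qed.

End Tangent.

Section VectorFields.
Context {R : realType} {n : nat} (M : manifold R n).

(* Vector fields, 1-forms, (1,1) tensor fields and metrics are pointwise fields;
   smoothness is tested on smooth functions and smooth vector fields. As
   functions they denote the induced operators: [X f] is the derivative of [f]
   along [X], and [eta X], [phi X], [g X Y] are taken pointwise. *)
Record vector_field := VectorField {
  vf_at : forall p : M, tangent p;
  vf_smooth : forall f : smooth_fun M, is_smooth (fun p => vf_at p f : R) }.

Definition vf_app (X : vector_field) (f : smooth_fun M) : smooth_fun M :=
  mk_sf (@vf_smooth X f).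
Coercion vf_app : vector_field >-> Funclass.

Lemma vf_ext (X Y : vector_field) : (forall f, X f = Y f) -> X = Y.
Proof.
case: X Y => [X Xs] [Y Ys] XY.
have e : X = Y.
  apply: functional_extensionality_dep => p; apply: tv_ext => f.
  by have /(congr1 (fun h : smooth_fun M => h p)) := XY f.
by rewrite e in Xs XY *; congr VectorField; exact: Prop_irrelevance.
Qed.

HB.instance Definition _ := gen_eqMixin vector_field.
HB.instance Definition _ := gen_choiceMixin vector_field.

Fact vf_zero_smooth (f : smooth_fun M) :
  is_smooth (fun p => (0 : tangent p) f : R).
Proof. exact: is_smooth_cst. Qed.
Definition vf_zero := VectorField vf_zero_smooth.

Fact vf_opp_smooth (X : vector_field) (f : smooth_fun M) :
  is_smooth (fun p => (- vf_at X p) f : R).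
Proof. exact: is_smoothN (@vf_smooth X f). Qed.
Definition vf_opp X := VectorField (vf_opp_smooth X).

Fact vf_add_smooth (X Y : vector_field) (f : smooth_fun M) :
  is_smooth (fun p => (vf_at X p + vf_at Y p) f : R).
Proof. exact: is_smoothD (@vf_smooth X f) (@vf_smooth Y f). Qed.
Definition vf_add X Y := VectorField (vf_add_smooth X Y).

Fact vf_scale_smooth (h : smooth_fun M) (X : vector_field) (f : smooth_fun M) :
  is_smooth (fun p => (h p *: vf_at X p) f : R).
Proof. exact: is_smoothM (is_smooth_sf h) (@vf_smooth X f). Qed.
Definition vf_scale h X := VectorField (vf_scale_smooth h X).

Fact vf_addA : associative vf_add.
Proof. by move=> X Y Z; apply: vf_ext => f; apply: sf_ext => p; exact: addrA. Qed.
Fact vf_addC : commutative vf_add.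
Proof. by move=> X Y; apply: vf_ext => f; apply: sf_ext => p; exact: addrC. Qed.
Fact vf_add0 : left_id vf_zero vf_add.
Proof. by move=> X; apply: vf_ext => f; apply: sf_ext => p; exact: add0r. Qed.
Fact vf_addN : left_inverse vf_zero vf_opp vf_add.
Proof. by move=> X; apply: vf_ext => f; apply: sf_ext => p; exact: addNr. Qed.

HB.instance Definition _ :=
  GRing.isZmodule.Build vector_field vf_addA vf_addC vf_add0 vf_addN.

Fact vf_scaleA f h X : vf_scale f (vf_scale h X) = vf_scale (f * h) X.
Proof. by apply: vf_ext => k; apply: sf_ext => p; exact: mulrA. Qed.
Fact vf_scale1 : left_id 1 vf_scale.
Proof. by move=> X; apply: vf_ext => k; apply: sf_ext => p; exact: mul1r. Qed.
Fact vf_scaleDr : right_distributive vf_scale +%R.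
Proof. by move=> f X Y; apply: vf_ext => k; apply: sf_ext => p; exact: mulrDr. Qed.
Fact vf_scaleDl X : {morph vf_scale^~ X : f h / f + h}.
Proof. by move=> f h; apply: vf_ext => k; apply: sf_ext => p; exact: mulrDl. Qed.

HB.instance Definition _ :=
  GRing.Zmodule_isLmodule.Build (smooth_fun M) vector_field
    vf_scaleA vf_scale1 vf_scaleDr vf_scaleDl.

Fact lie_derivation (X Y : vector_field) (p : M) :
  is_derivation_at p (fun f => vf_at X p (Y f) - vf_at Y p (X f)).
Proof.
have lin (Z : vector_field) a f h :
    Z (sf_cst M a * f + h) = sf_cst M a * Z f + Z h.
  by apply: sf_ext => q; have [+ _] := is_derivation_tv (vf_at Z q); apply.
have leib (Z : vector_field) f h : Z (f * h) = f * Z h + h * Z f.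
  by apply: sf_ext => q; have [_ +] := is_derivation_tv (vf_at Z q); apply.
have [X1 X2] := is_derivation_tv (vf_at X p).
have [Y1 Y2] := is_derivation_tv (vf_at Y p).
have XD f h : vf_at X p (f + h) = vf_at X p f + vf_at X p h.
  have := X1 1 f h; rewrite mul1r => <-; congr (vf_at X p (_ + h)).
  by apply: sf_ext => q; rewrite [RHS]mul1r.
have YD f h : vf_at Y p (f + h) = vf_at Y p f + vf_at Y p h.
  have := Y1 1 f h; rewrite mul1r => <-; congr (vf_at Y p (_ + h)).
  by apply: sf_ext => q; rewrite [RHS]mul1r.
split=> [a f h|f h].
  by rewrite !lin X1 Y1 mulrBr opprD addrACA.
rewrite !leib XD YD !X2 !Y2.
have vE (Z : vector_field) k : Z k p = vf_at Z p k by [].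
rewrite !vE.
have ringE (a b xyf xyh yxf yxh xf xh yf yh : R) :
    a * xyh + yh * xf + (b * xyf + yf * xh)
      - (a * yxh + xh * yf + (b * yxf + xf * yh))
    = a * (xyh - yxh) + b * (xyf - yxf) by ring.
exact: ringE.
Qed.

Fact lie_smooth (X Y : vector_field) (f : smooth_fun M) :
  is_smooth (fun p => mk_tv (lie_derivation X Y p) f : R).
Proof. exact: is_smoothD (@vf_smooth X (Y f)) (is_smoothN (@vf_smooth Y (X f))). Qed.

Definition lie (X Y : vector_field) : vector_field := VectorField (lie_smooth X Y).

End VectorFields.

Section TensorFields.
Context {R : realType} {n : nat} (M : manifold R n).
Local Notation vector_field := (vector_field M).

Record one_form := OneForm {
  form_at : forall p : M, {linear tangent p -> R^o};
  form_smooth : forall X : vector_field,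
    is_smooth (fun p => form_at p (vf_at X p) : R) }.

Definition form_app (eta : one_form) (X : vector_field) : smooth_fun M :=
  mk_sf (@form_smooth eta X).
Coercion form_app : one_form >-> Funclass.

(* (1,1) tensor fields *)
Record endo_field := EndoField {
  endo_at : forall p : M, {linear tangent p -> tangent p};
  endo_smooth : forall (X : vector_field) (f : smooth_fun M),
    is_smooth (fun p => endo_at p (vf_at X p) f : R) }.

Definition endo_app (phi : endo_field) (X : vector_field) : vector_field :=
  VectorField (@endo_smooth phi X).
Coercion endo_app : endo_field >-> Funclass.

Record riemannian_metric := RiemannianMetric {
  metric_at : forall p : M, tangent p -> tangent p -> R;
  metric_linear : forall p (a : R) (v w z : tangent p),
    metric_at (a *: v + w) z = a * metric_at v z + metric_at w z;
  metric_sym : forall p (v w : tangent p), metric_at v w = metric_at w v;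
  metric_pos : forall p (v : tangent p), v != 0 -> 0 < metric_at v v;
  metric_smooth : forall X Y : vector_field,
    is_smooth (fun p => metric_at (vf_at X p) (vf_at Y p)) }.

Definition metric_app (g : riemannian_metric) (X Y : vector_field) :
    smooth_fun M :=
  mk_sf (@metric_smooth g X Y).
Coercion metric_app : riemannian_metric >-> Funclass.

Record connection := Connection {
  conn_app :> vector_field -> vector_field -> vector_field;
  conn_linear : forall (f : smooth_fun M) (X Y Z : vector_field),
    conn_app (f *: X + Y) Z = f *: conn_app X Z + conn_app Y Z;
  conn_add : forall X Y Z : vector_field, conn_app X (Y + Z) = conn_app X Y + conn_app X Z;
  conn_leibniz : forall (X : vector_field) (f : smooth_fun M) (Y : vector_field),
    conn_app X (f *: Y) = X f *: Y + f *: conn_app X Y }.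

Definition torsion_free (D : connection) : Prop :=
  forall X Y : vector_field, D X Y - D Y X = lie X Y.

Definition metric_compatible (g : riemannian_metric) (D : connection) : Prop :=
  forall X Y Z : vector_field, X (g Y Z) = g (D X Y) Z + g Y (D X Z).

Definition levi_civita (g : riemannian_metric) (D : connection) : Prop :=
  torsion_free D /\ metric_compatible g D.

Definition curvature (D : connection) (X Y Z : vector_field) : vector_field :=
  D X (D Y Z) - D Y (D X Z) - D (lie X Y) Z.

(* [(D_X eta) Y] *)
Definition cov_form (D : connection) (eta : one_form) (X Y : vector_field) :
    smooth_fun M :=
  X (eta Y) - eta (D X Y).

(* [(D_X phi) Y] *)
Definition cov_endo (D : connection) (phi : endo_field) (X Y : vector_field) :
    vector_field :=
  D X (phi Y) - phi (D X Y).

Definition half : smooth_fun M := sf_cst M 2^-1.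

(* For a torsion-free [D] this is the exterior derivative normalized by
   [2 d eta (X, Y) = X (eta Y) - Y (eta X) - eta [X, Y]]. *)
Definition ext_deriv (D : connection) (eta : one_form) (X Y : vector_field) :
    smooth_fun M :=
  half * (cov_form D eta X Y - cov_form D eta Y X).

Definition metric_dual (g : riemannian_metric) (xi : vector_field)
    (eta : one_form) : Prop :=
  forall X, eta X = g xi X.

Definition sym_part (b : vector_field -> vector_field -> smooth_fun M) X Y :
    smooth_fun M :=
  half * (b X Y + b Y X).

Definition skew_part (b : vector_field -> vector_field -> smooth_fun M) X Y :
    smooth_fun M :=
  half * (b X Y - b Y X).

(* [R_0] *)
Definition curv0 (g : riemannian_metric) (X Y Z : vector_field) : vector_field :=
  g Y Z *: X - g X Z *: Y.

Section Expressions.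
Variables (g : riemannian_metric) (D : connection) (u : one_form)
  (U : vector_field) (phi1 phi2 : endo_field).

Definition beta (eta : one_form) (X Y : vector_field) : smooth_fun M :=
  cov_form D eta X Y + u X * eta (phi2 Y) - eta (phi1 X) * u Y
  + eta U * g (phi1 X) Y.

Definition alpha (eta : one_form) (X Y : vector_field) : smooth_fun M :=
  cov_form D eta X Y + u X * eta (phi2 Y) - eta (phi1 X) * u Y
  + half * eta U * g (phi1 X) Y.

(* In [Bfield] and [Afield], [xi] is the vector field dual to [eta]. *)
Definition Bfield (eta : one_form) (xi X : vector_field) : vector_field :=
  D X xi - u X *: phi2 xi - eta (phi1 X) *: U + eta U *: phi1 X.

Definition Afield (eta : one_form) (xi X : vector_field) : vector_field :=
  D X xi - u X *: phi2 xi - eta (phi1 X) *: U + (half * eta U) *: phi1 X.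

Definition mu (X Y : vector_field) : vector_field :=
  cov_endo D phi1 X Y - u X *: phi2 (phi1 Y).

End Expressions.

End TensorFields.

(* Main.v *)
Require Import Defs.
From mathcomp Require Import all_boot all_order all_algebra.
From mathcomp Require Import all_classical all_reals all_analysis.
From mathcomp Require Import ring.

Import GRing.Theory.
Local Open Scope ring_scope.

(** Write [Dt = D + H] with [H] the difference tensor. The curvature of any
    deformed connection is
      [R + (D_X H)(Y, Z) - (D_Y H)(X, Z) + H(X, H(Y, Z)) - H(Y, H(X, Z))]
    (lemma [curvature_deformation]), where torsion-freeness of [D] turns the
    term [H([X, Y], Z)] into the two terms that make [D_X H] a covariant
    derivative. As [D] is metric, [D_X H] obeys the product rule with the metric
    treated as a constant (lemma [cov_difference_tensor]), which yields all the
    terms containing a derivative: [du], [du1], the covariant derivatives inside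
    [alpha], [beta], [A], [B], [mu], and the derivatives of [f1] and [f2].

    The rest is the algebra of the quadratic terms. It uses three facts: [u],
    [u1], [u2] are inner products with [U], [U1], [U2], the endomorphism [phi1]
    is self-adjoint, and [phi2] is skew-adjoint. After these are used to bring
    all inner products to a common form, the two sides are the same combination
    of vector fields with coefficients in the commutative ring of smooth
    functions; letting both act on an arbitrary function turns this into a
    polynomial identity in that ring. The factor 1/2 in [alpha u] and [A u],
    against 1 in [beta] and [B], is there because for [eta = u] the term
    [u(U) g(phi1 Y, Z) phi1 X] arises once but appears in both [alpha] and [A]. *)

(** * Linearity and product rules *)

Section Tensoriality.
Context {R : realType} {n : nat} {M : manifold R n}.
Implicit Types (X Y Z : vector_field M) (f h : smooth_fun M).

Lemma vf_appD X Y f : (X + Y) f = X f + Y f.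
Proof. exact: sf_ext. Qed.

Lemma vf_appN X f : (- X) f = - X f.
Proof. exact: sf_ext. Qed.

Lemma vf_appZ h X f : (h *: X) f = h * X f.
Proof. exact: sf_ext. Qed.

Lemma vf_derD X f h : X (f + h) = X f + X h.
Proof.
apply: sf_ext => p; have [/(_ 1 f h) XD _] := is_derivation_tv (vf_at X p).
have f1 : f = sf_cst M 1 * f by apply: sf_ext => q; rewrite [RHS]mul1r.
(* additivity of a tangent vector is the case a = 1 of its linearity *)
by rewrite [in LHS]f1; apply: etrans XD _; rewrite mul1r.
Qed.

Lemma vf_derM X f h : X (f * h) = f * X h + h * X f.
Proof.
by apply: sf_ext => p; have [_] := is_derivation_tv (vf_at X p); apply.
Qed.

Lemma endo_appD (phi : endo_field M) X Y : phi (X + Y) = phi X + phi Y.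
Proof.
apply: vf_ext => f; apply: sf_ext => p.
have := raddfD (endo_at phi p) (vf_at X p) (vf_at Y p).
by move=> /(congr1 (fun v : tangent p => tv v f)).
Qed.

Lemma endo_appZ (phi : endo_field M) h X : phi (h *: X) = h *: phi X.
Proof.
apply: vf_ext => f; apply: sf_ext => p.
have := linearZ_LR (endo_at phi p) (h p) (vf_at X p).
by move=> /(congr1 (fun v : tangent p => tv v f)).
Qed.

Lemma endo_appN (phi : endo_field M) X : phi (- X) = - phi X.
Proof. by rewrite -scaleN1r endo_appZ scaleN1r. Qed.

Lemma form_appD (eta : one_form M) X Y : eta (X + Y) = eta X + eta Y.
Proof. by apply: sf_ext => p; exact: (linearD (form_at eta p)). Qed.

Lemma form_appZ (eta : one_form M) h X : eta (h *: X) = h * eta X.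
Proof. by apply: sf_ext => p; exact: (linearZ_LR (form_at eta p)). Qed.

Lemma form_appN (eta : one_form M) X : eta (- X) = - eta X.
Proof. by rewrite -scaleN1r form_appZ mulN1r. Qed.

Section Metric.
Variable g : riemannian_metric M.

Lemma metric_appC X Y : g X Y = g Y X.
Proof. by apply: sf_ext => p; exact: (Defs.metric_sym g (vf_at X p)). Qed.

Lemma metric_appDl X Y Z : g (X + Y) Z = g X Z + g Y Z.
Proof.
apply: sf_ext => p; have := metric_linear g 1 (vf_at X p) (vf_at Y p) (vf_at Z p).
by rewrite scale1r mul1r.
Qed.

Lemma metric_appZl h X Y : g (h *: X) Y = h * g X Y.
Proof.
apply: sf_ext => p; set v := vf_at Y p.
have g0 : metric_at g 0 v = 0.
  have := metric_linear g 1 0 0 v; rewrite scale1r mul1r addr0.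
  by rewrite -[X in X = _]addr0 => /addrI.
have := metric_linear g (h p) (vf_at X p) 0 v.
by rewrite g0 !addr0.
Qed.

Lemma metric_appNl X Y : g (- X) Y = - g X Y.
Proof. by rewrite -scaleN1r metric_appZl mulN1r. Qed.

Lemma metric_appDr X Y Z : g X (Y + Z) = g X Y + g X Z.
Proof. by rewrite metric_appC metric_appDl !(metric_appC _ X). Qed.

Lemma metric_appZr h X Y : g X (h *: Y) = h * g X Y.
Proof. by rewrite metric_appC metric_appZl metric_appC. Qed.

Lemma metric_appNr X Y : g X (- Y) = - g X Y.
Proof. by rewrite metric_appC metric_appNl metric_appC. Qed.

End Metric.

Section Connection.
Variable D : connection M.

Lemma conn_appDl X Y Z : D (X + Y) Z = D X Z + D Y Z.
Proof. by rewrite -[X in D (X + _)]scale1r conn_linear scale1r. Qed.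

Lemma conn_appNl X Z : D (- X) Z = - D X Z.
Proof.
have D0 : D 0 Z = 0.
  by apply: (@addrI _ (D 0 Z)); rewrite -conn_appDl !addr0.
by apply: (@addrI _ (D X Z)); rewrite -conn_appDl !subrr.
Qed.

Lemma conn_appNr X Y : D X (- Y) = - D X Y.
Proof.
have D0 : D X 0 = 0 by apply: (@addrI _ (D X 0)); rewrite -conn_add !addr0.
by apply: (@addrI _ (D X Y)); rewrite -conn_add !subrr.
Qed.

End Connection.

End Tensoriality.

Definition vf_appE {R : realType} {n : nat} {M : manifold R n} :=
  (@vf_appD R n M, @vf_appN R n M, @vf_appZ R n M).

Definition endo_appE {R : realType} {n : nat} {M : manifold R n} :=
  (@endo_appD R n M, @endo_appN R n M, @endo_appZ R n M).

Definition form_appE {R : realType} {n : nat} {M : manifold R n} :=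
  (@form_appD R n M, @form_appN R n M, @form_appZ R n M).

Definition metric_appE {R : realType} {n : nat} {M : manifold R n} :=
  (@metric_appDl R n M, @metric_appNl R n M, @metric_appZl R n M,
   @metric_appDr R n M, @metric_appNr R n M, @metric_appZr R n M).

(** * Curvature of a deformed connection *)

Section Deformation.
Context {R : realType} {n : nat} {M : manifold R n}.
Variable D : connection M.
Implicit Types (X Y Z : vector_field M) (f : smooth_fun M).
Implicit Types (H : vector_field M -> vector_field M -> vector_field M).

(** The covariant derivative [(D_X H)(Y, Z)] of a vector-valued bilinear map. *)
Definition cov_bilinear H X Y Z : vector_field M :=
  D X (H Y Z) - H (D X Y) Z - H Y (D X Z).

(** Expanding [Dt X (Dt Y Z) - Dt Y (Dt X Z)] gives the curvature of [D], the
    quadratic terms, and first-order terms that are those of [D_X H] and [D_Y H]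
    up to [H(D_X Y, Z) - H(D_Y X, Z) = H([X, Y], Z)]. *)
Lemma curvature_deformation H (Dt : connection M) X Y Z :
  torsion_free D -> (forall V W, Dt V W = D V W + H V W) ->
  curvature Dt X Y Z = curvature D X Y Z
    + (cov_bilinear H X Y Z - cov_bilinear H Y X Z)
    + (H X (H Y Z) - H Y (H X Z)).
Proof.
move=> tfD DtE.
have HE V W : H V W = Dt V W - D V W by rewrite DtE addrC addKr.
(* H is biadditive because it is a difference of two connections. *)
have HDr V W W' : H V (W + W') = H V W + H V W'.
  by rewrite !HE !conn_add opprD addrACA.
have HBl V V' W : H (V - V') W = H V W - H V' W.
  by rewrite !HE !(conn_appDl, conn_appNl) !opprD addrACA.
rewrite /curvature /cov_bilinear !DtE !conn_add !HDr -(tfD X Y) HBl.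
apply: vf_ext => f; rewrite !vf_appE; ring.
Qed.

End Deformation.

(** * The difference tensor *)

Section DifferenceTensor.
Context {R : realType} {n : nat} {M : manifold R n}.
Variables (g : riemannian_metric M) (D : connection M).
Variables (f1 f2 : smooth_fun M) (u u1 : one_form M).
Variables (U U1 U2 : vector_field M) (phi1 phi2 : endo_field M).
Implicit Types (X Y Z : vector_field M).

Definition difference_tensor X Y : vector_field M :=
  u Y *: phi1 X - u X *: phi2 Y - g (phi1 X) Y *: U
  - f1 *: (u1 X *: Y + u1 Y *: X - g X Y *: U1) - (f2 * g X Y) *: U2.

(** The Leibniz rule applied to each product; no derivative of [g] appears
    because [g] is parallel. *)
Lemma cov_difference_tensor X Y Z : metric_compatible g D ->
  cov_bilinear D difference_tensor X Y Z =
    cov_form D u X Z *: phi1 Y + u Z *: cov_endo D phi1 X Y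
    - cov_form D u X Y *: phi2 Z - u Y *: cov_endo D phi2 X Z
    - g (cov_endo D phi1 X Y) Z *: U - g (phi1 Y) Z *: D X U
    - f1 *: (cov_form D u1 X Y *: Z + cov_form D u1 X Z *: Y
             - g Y Z *: D X U1)
    - X f1 *: (u1 Y *: Z + u1 Z *: Y - g Y Z *: U1)
    - (f2 * g Y Z) *: D X U2 - (X f2 * g Y Z) *: U2.
Proof.
move=> gD; rewrite /cov_bilinear /difference_tensor /cov_endo /cov_form.
rewrite !(conn_add, conn_appNr, conn_leibniz, metric_appE) vf_derM !gD.
apply: vf_ext => h; rewrite !vf_appE; ring.
Qed.

End DifferenceTensor.

(** * The curvature formula *)

Lemma two_half {R : realType} {n : nat} (M : manifold R n) :
  2 * Defs.half M = 1.
Proof.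
rewrite mulr_natl mulr2n; apply: sf_ext => p.
rewrite -[LHS]/((2^-1 : R) + 2^-1) -[RHS]/(1 : R).
by field.
Qed.

Theorem mainTheorem2 (R : realType) (n : nat) (M : manifold R n)
  (g : riemannian_metric M) (D : connection M) (hD : levi_civita g D)
  (f1 f2 : smooth_fun M) (u u1 u2 : one_form M) (phi : endo_field M)
  (U U1 U2 : vector_field M)
  (hU : metric_dual g U u) (hU1 : metric_dual g U1 u1)
  (hU2 : metric_dual g U2 u2)
  (phi1 phi2 : endo_field M)
  (hphi : forall X : vector_field M, phi X = phi1 X + phi2 X)
  (hphi1 : forall X Y : vector_field M,
     g (phi1 X) Y = sym_part (fun V W => g (phi V) W) X Y)
  (hphi2 : forall X Y : vector_field M,
     g (phi2 X) Y = skew_part (fun V W => g (phi V) W) X Y)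
  (Dt : connection M)
  (hDt : forall X Y : vector_field M,
     Dt X Y = D X Y + u Y *: phi1 X - u X *: phi2 Y - g (phi1 X) Y *: U
              - f1 *: (u1 X *: Y + u1 Y *: X - g X Y *: U1)
              - (f2 * g X Y) *: U2) :
  let alpha := alpha g D u U phi1 phi2 in
  let beta := beta g D u U phi1 phi2 in
  let A := Afield D u U phi1 phi2 in
  let B := Bfield D u U phi1 phi2 in
  let mu := mu D u phi1 phi2 in
  let R0 := curv0 g in
  let d := ext_deriv D in
  forall X Y Z : vector_field M,
    curvature Dt X Y Z =
      curvature D X Y Z - (2 * d u X Y) *: phi2 Z
      - alpha u Y Z *: phi1 X + alpha u X Z *: phi1 Y
      - g (phi1 Y) Z *: A u U X + g (phi1 X) Z *: A u U Y
      - R0 U (mu X Y - mu Y X) Z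
      + u X *: cov_endo D phi2 Y Z - u Y *: cov_endo D phi2 X Z
      - f1 *: ((2 * d u1 X Y) *: Z - beta u1 Y Z *: X + beta u1 X Z *: Y
               - g Y Z *: B u1 U1 X + g X Z *: B u1 U1 Y
               + u Y *: R0 (phi X) U1 Z - u X *: R0 (phi Y) U1 Z)
      + f2 *: ((g (phi Y) Z * u X) *: U2 - (g (phi X) Z * u Y) *: U2
               - g Y Z *: B u2 U2 X + g X Z *: B u2 U2 Y)
      - (f1 ^+ 2) *: (g Y Z *: R0 X U1 U1 - g X Z *: R0 Y U1 U1
                      - u1 Z *: R0 X Y U1)
      + (f2 ^+ 2) *: ((g Y Z * u2 X) *: U2 - (g X Z * u2 Y) *: U2)
      + (f1 * f2) *: (g Y Z *: (R0 X U2 U1 - u2 X *: U1)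
                      - g X Z *: (R0 Y U2 U1 - u2 Y *: U1))
      - X f1 *: (u1 Y *: Z + u1 Z *: Y - g Y Z *: U1)
      + Y f1 *: (u1 X *: Z + u1 Z *: X - g X Z *: U1)
      - (X f2 * g Y Z) *: U2 + (Y f2 * g X Z) *: U2.
Proof.
move=> al be A B m R0 d X Y Z; case: hD => tfD gD.
have gl W : (g U W = u W) * (g U1 W = u1 W) * (g U2 W = u2 W).
  by rewrite hU hU1 hU2.
have gr W : (g W U = u W) * (g W U1 = u1 W) * (g W U2 = u2 W).
  by rewrite !(metric_appC g W) !gl.
have guC : (u1 U = u U1) * (u2 U = u U2) * (u2 U1 = u1 U2).
  by split; [split|]; rewrite ?hU ?hU1 ?hU2 metric_appC.
have phi1_sym V W : g V (phi1 W) = g (phi1 V) W.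
  by rewrite metric_appC !hphi1 /sym_part addrC.
have phi1_swap V W : g (phi1 V) W = g (phi1 W) V.
  by rewrite -phi1_sym metric_appC.
have phi2_skew V W : g V (phi2 W) = - g (phi2 V) W.
  by rewrite metric_appC !hphi2 /skew_part -mulrN opprB.
have DtE V W :
    Dt V W = D V W + difference_tensor g f1 f2 u u1 U U1 U2 phi1 phi2 V W.
  by rewrite hDt /difference_tensor !addrA.
rewrite (curvature_deformation D _ _ _ _ _ tfD DtE) !cov_difference_tensor //.
rewrite /al /be /A /B /m /R0 /d /alpha /beta /Afield /Bfield /mu /curv0.
rewrite /ext_deriv /difference_tensor !hphi.
(* Canonical form of the inner products: those with U, U1, U2 become values of
   u, u1, u2, and phi1, phi2 are moved to the first argument. *)
rewrite !(metric_appE, form_appE, endo_appE).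
rewrite ?(gl, gr, phi1_sym, phi2_skew) ?guC.
(* The remaining expressions symmetric in X and Y are written with X first. *)
rewrite -(metric_appC g X Y) -!(phi1_swap X Y).
rewrite (_ : g (phi1 (phi1 Y)) X = g (phi1 (phi1 X)) Y); last first.
  by rewrite phi1_swap phi1_sym.
apply: vf_ext => h; rewrite !vf_appE.
(* The halves are removed: 2 * half cancels in the exterior derivatives, and
   u U is replaced by twice w = u U / 2, the coefficient in alpha u and A u. *)
have half2 := two_half M; rewrite !(mulrA 2) half2 !mul1r.
have [w wE] : {w | Defs.half M * u U = w} by exists (Defs.half M * u U).
have uU : u U = 2 * w by rewrite -wE mulrA half2 mul1r.
rewrite !wE !uU; ring.
Qed.
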